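(* Let $C=(C_n)_{n\ge1}$ be a strong divisibility sequence, let $p$ be an acceptable prime for $C$ with an integer $s(p)\ge1$ as in the definition of acceptable, let $k\ge2$ be an integer, and let $e=\begin{bmatrix}1&0&\cdots&0\end{bmatrix}\in\mathbb{Z}^k$. Then for any integer $n\ge0$ with standard base-$p$ representation $n=n_\ell\cdots n_1n_0$, and for any integer $0\le r<\alpha(p^{s(p)})$, \[ T_{p,k,C}(\alpha(p^{s(p)})\cdot n+r,x)=u_{p,k,C}(r)\,M_{p,k}(n_0)M_{p,k}(n_1)\cdots M_{p,k}(n_\ell)\,e^{\intercal}, \] where $u_{p,k,C}(r)=\begin{bmatrix}u_{p,k,C,0}(r)&\cdots&u_{p,k,C,k-1}(r)\end{bmatrix}$ with \[ u_{p,k,C,\lambda}(r)=\sum_{\substack{\mathbf r=(r_1,\dots,r_k)\in\{0,1,\dots,\alpha(p^{s(p)})-1\}^k\\ r_1+\cdots+r_k=r+\lambda\alpha(p^{s(p)})}}x^{f_{p,k,C,\lambda}(r,\mathbf r)-\lambda}, \] \[ f_{p,k,C,\lambda}(r,\mathbf r)=\lambda\sum_{j=1}^{s(p)}\frac{\alpha(p^{s(p)})}{\alpha(p^j)}+\sum_{j=1}^{s(p)}\left(\left\lfloor\frac{r}{\alpha(p^j)}\right\rfloor-\sum_{i=1}^k\left\lfloor\frac{r_i}{\alpha(p^j)}\right\rfloor\right). \]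
   Context: A strong divisibility sequence is a sequence $C=C_1,C_2,\dots$ of nonzero integers with $\gcd(C_n,C_m)=C_{\gcd(n,m)}$ for all positive $n,m$. The $C$-orial is $0!_C=1$, $n!_C=C_nC_{n-1}\cdots C_1$ for $n\ge1$. For $\mathbf m=(m_1,\dots,m_k)\in\mathbb N^k$ ($\mathbb N$ includes $0$) write $\operatorname{tot}\mathbf m=m_1+\cdots+m_k$; for $\operatorname{tot}\mathbf m=n$ the $C$-multinomial is $\binom{n}{m_1,\dots,m_k}_C=\frac{n!_C}{m_1!_C\cdots m_k!_C}$. For a prime $p$, $\nu_p$ is the $p$-adic valuation and $T_{p,k,C}(n,x)=\sum_{\mathbf m\in\mathbb N^k,\ \operatorname{tot}\mathbf m=n}x^{\nu_p(\binom{n}{m_1,\dots,m_k}_C)}$. The rank of apparition $\alpha(m)$ is the least index $j\ge1$ with $m\mid C_j$ (if it exists). When $\alpha(p^k)$ exists for all $k\ge1$, set $a_k(p)=\alpha(p^k)/\alpha(p^{k-1})$ for $k\ge2$. The prime $p$ is acceptable for $C$ if $\alpha(p^k)$ exists for all $k\ge1$ and there is an integer $s(p)\ge1$ such that $a_k(p)$ is a (positive) integer for $2\le k\le s(p)$ and $a_k(p)=p$ for $k>s(p)$. For $d\in\{0,\dots,p-1\}$, $M_{p,k}(d)$ is the $k\times k$ matrix with rows and columns indexed by $\mu,\lambda\in\{0,1,\dots,k-1\}$ whose $(\mu,\lambda)$ entry is $x^{\mu}N_{p,k}(d-\mu+\lambda p)$, where $N_{p,k}(t)$ denotes the number of tuples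 $(d_1,\dots,d_k)\in\{0,1,\dots,p-1\}^k$ with $d_1+\cdots+d_k=t$ (so $N_{p,k}(t)=0$ for $t<0$). *)

(* Defs.v *)
From mathcomp Require Import all_boot all_order all_algebra.
From mathcomp Require Import boolp.

Set Implicit Arguments.
Unset Strict Implicit.
Unset Printing Implicit Defensive.

Import Order.TTheory GRing.Theory Num.Theory.
Local Open Scope ring_scope.

(* Sequences C_1, C_2, ... are functions nat -> int; the value at 0 is never
   used. *)

Definition strong_divisibility (C : nat -> int) : Prop :=
  (forall n : nat, (0 < n)%N -> C n != 0) /\
  (forall n m : nat, (0 < n)%N -> (0 < m)%N ->
     gcdz (C n) (C m) = C (gcdn n m)).

Definition orial (C : nat -> int) (n : nat) : int :=
  \prod_(1 <= i < n.+1) C i.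

(* Taken in rat, so that integrality is not built into the definition. *)
Definition cmultinomial (C : nat -> int) (k n : nat) (m : 'I_k -> nat) : rat :=
  (orial C n)%:~R / \prod_(i < k) (orial C (m i))%:~R.

Definition padic_val (p : nat) (q : rat) : int :=
  (logn p `|numq q|)%:Z - (logn p `|denq q|)%:Z.

(* Identities between polynomials in x are stated in the field Q(x), which
   contains Z[x]; exponents of x are integers, so no truncation of a
   difference occurs. *)
Notation ratfun := {fraction {poly int}}.

Definition xvar : ratfun := tofrac 'X.

(* A k-tuple of naturals of total n has all its entries at most n, hence the
   finite index type. *)
Definition Tsum (p k : nat) (C : nat -> int) (n : nat) : ratfun :=
  \sum_(m : {ffun 'I_k -> 'I_n.+1} | (\sum_(i < k) m i == n)%N)
    xvar ^ padic_val p (cmultinomial C n (fun i => m i)).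

Definition appears (C : nat -> int) (m : nat) : Prop :=
  exists j : nat, (0 < j)%N && (m%:Z %| C j)%Z.

(* The value 0 is a default, used when m divides no C_j with j >= 1. *)
Definition alpha (C : nat -> int) (m : nat) : nat :=
  if pselect (appears C m) is left h then ex_minn h else 0%N.

Definition rank_ratio (C : nat -> int) (p k : nat) : rat :=
  (alpha C (p ^ k))%:R / (alpha C (p ^ k.-1))%:R.

(* The prime p is acceptable for C, with s as a value of s(p). *)
Definition acceptable (C : nat -> int) (p s : nat) : Prop :=
  [/\ prime p,
      forall k : nat, (1 <= k)%N -> appears C (p ^ k),
      (1 <= s)%N,
      forall k : nat, (2 <= k <= s)%N ->
        rank_ratio C p k \is a Num.int /\ 0 < rank_ratio C p k
    & forall k : nat, (s < k)%N -> rank_ratio C p k = p%:R].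

Definition Ntuples (p k : nat) (t : int) : nat :=
  #|[set d : {ffun 'I_k -> 'I_p} | (\sum_(i < k) d i)%N%:Z == t]|.

Definition Mmat (p k d : nat) : 'M[ratfun]_k :=
  \matrix_(mu < k, lam < k)
    (xvar ^+ mu * (Ntuples p k (d%:Z - mu%:Z + lam%:Z * p%:Z))%:R).

(* The quotients alpha(p^s) / alpha(p^j) are exact for 1 <= j <= s when p is
   acceptable: they are products of the integers a_i(p), j < i <= s. *)
Definition fexp (p k : nat) (C : nat -> int) (s lam r : nat) (rr : 'I_k -> nat)
    : int :=
  lam%:Z * (\sum_(1 <= j < s.+1) (alpha C (p ^ s) %/ alpha C (p ^ j))%N%:Z) +
  \sum_(1 <= j < s.+1)
    ((r %/ alpha C (p ^ j))%N%:Z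
     - \sum_(i < k) (rr i %/ alpha C (p ^ j))%N%:Z).

Definition u_coef (p k : nat) (C : nat -> int) (s lam r : nat) : ratfun :=
  \sum_(rr : {ffun 'I_k -> 'I_(alpha C (p ^ s))}
        | (\sum_(i < k) rr i == r + lam * alpha C (p ^ s))%N)
    xvar ^ (fexp p C s lam r (fun i => rr i) - lam%:Z).

Definition urow (p k : nat) (C : nat -> int) (s r : nat) : 'rV[ratfun]_k :=
  \row_(lam < k) u_coef p k C s lam r.

Definition erow (k : nat) : 'rV[ratfun]_k := \row_(i < k) (i == 0%N :> nat)%:R.

(* ds = [:: n_0; ...; n_l], least significant digit first; the standard
   representation of 0 is the single digit 0. *)
Definition base_repr (p n : nat) (ds : seq nat) : Prop :=
  [/\ (0 < size ds)%N,
      all (fun d => (d < p)%N) ds,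
      (last 0%N ds != 0%N) || (size ds == 1%N)
    & n = (\sum_(i < size ds) nth 0 ds i * p ^ i)%N].

(* Main.v *)
(* Strong divisibility gives [p ^ j %| C m] iff [alpha (p ^ j) %| m], so the
   valuation of the C-orial of N is the sum of the floors [N / alpha (p ^ j)].
   Writing [a = alpha (p ^ s)], acceptability makes the terms with [j > s] add
   up to Legendre's formula for the ordinary factorial of [N / a].
   Dividing all entries of a tuple of total [a * n + r] by [a] splits [Tsum]
   into sums over remainders of total [r + lam * a] (the row [urow]) and sums
   over quotients of total [n - lam]. The latter only involve ordinary
   factorials; dividing their entries by [p] shows that prepending a digit [d]
   to the base-[p] expansion of [n] multiplies them by [Mmat p k d], where [mu]
   and [lam] are the incoming and outgoing carries. *)
Require Import Defs.
From mathcomp Require Import all_boot all_order all_algebra.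
From mathcomp Require Import boolp zify.

Set Implicit Arguments.
Unset Strict Implicit.
Unset Printing Implicit Defensive.

Import Order.TTheory GRing.Theory Num.Theory.
Local Open Scope ring_scope.

(** * Valuations of quotients, products and factorials *)

(** Cross-multiplying [a / b] with its reduced form gives an identity of nonzero integers, on which
    [logn] is additive; no gcd has to be cancelled. *)
Lemma padic_val_div (p : nat) (a b : int) : a != 0 -> b != 0 ->
  padic_val p (a%:~R / b%:~R) = (logn p `|a|)%:Z - (logn p `|b|)%:Z.
Proof.
move=> a0 b0; set q := a%:~R / b%:~R.
have d0 : denq q != 0 by exact: denq_neq0.
have n0 : numq q != 0.
  by rewrite numq_eq0 mulf_neq0 ?invr_eq0 // intr_eq0.
have cross : a * denq q = numq q * b.
  apply: (@intr_inj rat); rewrite !intrM.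
  have : (numq q)%:~R / (denq q)%:~R = a%:~R / b%:~R :> rat.
    by rewrite divq_num_den.
  by move/eqP; rewrite eqr_div ?intr_eq0 // => /eqP ->.
have := congr1 (fun z : int => logn p `|z|%N) cross.
rewrite !abszM !lognM ?absz_gt0 // /padic_val => H; lia.
Qed.

Lemma logn_prod (p : nat) (I : finType) (F : I -> int) :
  (forall i, F i != 0) ->
  logn p `|\prod_i F i| = (\sum_i logn p `|F i|)%N.
Proof.
move=> F0.
(* Nonvanishing is carried along because [lognM] needs positive factors. *)
pose K (z : int) (m : nat) := z != 0 /\ logn p `|z| = m.
suff [] : K (\prod_i F i) (\sum_i logn p `|F i|)%N by [].
apply: (big_ind2 K) => [|x m y n [x0 <-] [y0 <-]|i _]; rewrite /K.
- by rewrite oner_eq0 logn1.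
- by rewrite mulf_neq0 // abszM lognM // absz_gt0.
- by rewrite F0.
Qed.

(** One step of Legendre's formula: only the multiples of [p] up to [m] count, and their cofactors
    are 1, ..., [m %/ p]. *)
Lemma logn_fact_div (p m : nat) : prime p ->
  logn p m`! = (m %/ p + logn p (m %/ p)`!)%N.
Proof.
move=> pr_p; have p0 := prime_gt0 pr_p.
elim: m => [|m IH]; first by rewrite div0n.
rewrite factS lognM ?fact_gt0 // IH divnS //.
case: (boolP (p %| m.+1)%N) => [/dvdnP [c Ec]|ndv]; last first.
  by rewrite logn_coprime ?prime_coprime // add0n.
have Ecm : c = (m %/ p).+1.
  by move: (divnS m p0); rewrite Ec mulnK // dvdn_mull // add1n.
rewrite Ec lognM //; last by rewrite Ecm.
by rewrite (pfactorK 1 pr_p) add1n factS lognM ?fact_gt0 // Ecm; lia.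
Qed.

(** * Ranks of apparition and the valuation of the C-orial *)

Section Apparition.

Context (C : nat -> int) (hC : strong_divisibility C).

Lemma orial_neq0 (n : nat) : orial C n != 0.
Proof.
have [C0 _] := hC; rewrite /orial big_nat.
by apply: (big_ind (fun z => z != 0)) => [//|x y|i /andP [i0 _]];
  [exact: mulf_neq0 | exact: C0].
Qed.

Lemma alpha_gt0 (q : nat) : appears C q -> (0 < alpha C q)%N.
Proof.
by rewrite /alpha; case: pselect => // h _; case: ex_minnP => m /andP [].
Qed.

(** If [q] divides both [C a] and [C m], it divides [C (gcdn a m)], so minimality of [a] forces
    [gcdn a m = a]. Conversely, [a %| m] makes [C a] divide [C m]. *)
Lemma dvd_alpha (q m : nat) : appears C q -> (0 < m)%N ->
  (q%:Z %| C m)%Z = (alpha C q %| m)%N.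
Proof.
have [C0 Cgcd] := hC.
rewrite /alpha; case: pselect => // h _ m0.
case: ex_minnP => a /andP [a0 dva] amin.
apply/idP/idP => [dvm|/gcdn_idPl Ea].
  have : (a <= gcdn a m)%N.
    by apply: amin; rewrite gcdn_gt0 a0 -Cgcd // dvdz_gcd dva.
  move=> le; apply/gcdn_idPl/anti_leq.
  by rewrite le andbT dvdn_leq // dvdn_gcdl.
by apply: (dvdz_trans dva); rewrite -{1}Ea -Cgcd // dvdz_gcdr.
Qed.

Context (p s : nat) (hp : acceptable C p s).

Let a (j : nat) : nat := alpha C (p ^ j).

Lemma acc_alpha_gt0 (j : nat) : (0 < j)%N -> (0 < a j)%N.
Proof. by have [_ happ _ _ _] := hp => /happ /alpha_gt0. Qed.

Lemma leq_logn_alpha (j m : nat) : (0 < j)%N -> (0 < m)%N ->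
  (j <= logn p `|C m|)%N = (a j %| m)%N.
Proof.
have [pr_p happ _ _ _] := hp; have [C0 _] := hC => j0 m0.
by rewrite -(dvd_alpha (happ _ j0) m0) dvdzE -pfactor_dvdn ?absz_gt0 ?C0.
Qed.

Lemma acc_alpha_dvd (i j : nat) : (0 < i <= j)%N -> (a i %| a j)%N.
Proof.
move=> /andP [i0 ij]; have j0 := leq_trans i0 ij.
have aj0 := acc_alpha_gt0 j0.
by rewrite -leq_logn_alpha // (leq_trans ij) // leq_logn_alpha.
Qed.

Lemma acc_alpha_expn (j : nat) : a (s + j) = (a s * p ^ j)%N.
Proof.
have [_ _ s0 _ hrat] := hp.
elim: j => [|j IH]; first by rewrite addn0 muln1.
have sj0 : (0 < s + j)%N by rewrite addn_gt0 s0.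
have ap0 : (a (s + j))%:R != 0 :> rat.
  by rewrite pnatr_eq0 -lt0n acc_alpha_gt0.
have lt : (s < s + j.+1)%N by rewrite -addSnnS leq_addr.
have := hrat _ lt; rewrite /rank_ratio addnS /= => H.
have {}H : (a (s + j).+1)%:R = (p * a (s + j))%:R :> rat.
  by rewrite natrM -H mulfVK.
by move/eqP: H; rewrite eqr_nat => /eqP ->; rewrite IH expnS mulnCA.
Qed.

(** Levels up to [s] are counted one by one. Above [s] the ranks are [a s * p ^ j], so the remaining
    levels measure the valuation of [m %/ a s]. *)
Lemma logn_acc (m : nat) : (0 < m)%N ->
  logn p `|C m| = (\sum_(1 <= j < s.+1) (a j %| m) +
                   (if a s %| m then logn p (m %/ a s) else 0))%N.
Proof.
have [pr_p _ s0 _ _] := hp => m0; have as0 := acc_alpha_gt0 s0.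
have -> : (\sum_(1 <= j < s.+1) (a j %| m) = minn s (logn p `|C m|))%N.
  rewrite (@eq_big_nat _ _ _ _ _ _ (fun j => (j <= logn p `|C m|)%N : nat)).
    move: (logn p _) => v; elim: (s) => [|t IH].
      by rewrite big_geq // min0n.
    by rewrite big_nat_recr //= IH; lia.
  by move=> j /andP [j0 _]; rewrite leq_logn_alpha.
case: ifPn => [dv|]; last by rewrite -leq_logn_alpha // -ltnNge; lia.
have ls : (s <= logn p `|C m|)%N by rewrite leq_logn_alpha.
have q0 : (0 < m %/ a s)%N by rewrite divn_gt0 // dvdn_leq.
have key j : (s + j <= logn p `|C m|)%N = (j <= logn p (m %/ a s))%N.
  rewrite leq_logn_alpha ?addn_gt0 ?s0 // acc_alpha_expn -pfactor_dvdn //.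
  by rewrite -{1}(divnK dv) mulnC dvdn_pmul2r.
(* These two instances of [key] give the two inequalities between [logn p (m %/ a s)] and the excess
   of the valuation over [s]. *)
have := key (logn p `|C m| - s)%N; have := key (logn p (m %/ a s)).
rewrite leqnn subnKC // leqnn; lia.
Qed.

Lemma logn_orial (N : nat) :
  logn p `|orial C N| =
    (\sum_(1 <= j < s.+1) (N %/ a j) + logn p (N %/ a s)`!)%N.
Proof.
have [pr_p _ s0 _ _] := hp; have as0 := acc_alpha_gt0 s0.
have [C0 _] := hC.
elim: N => [|N IH].
  by rewrite /orial big_geq // div0n logn1 big1 // => j _; rewrite div0n.
rewrite /orial big_nat_recr //= -/(orial C N) abszM lognM ?absz_gt0;
  [|exact: orial_neq0|exact: C0].
rewrite IH logn_acc // [in RHS](@eq_big_nat _ _ _ _ _ _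
  (fun j => (a j %| N.+1) + N %/ a j)%N); last first.
  by move=> j /andP [j0 _]; rewrite divnS // acc_alpha_gt0.
rewrite big_split /= (divnS N as0).
case: (boolP (a s %| N.+1)%N) => _; last first.
  by rewrite (add0n (N %/ a s)%N); lia.
rewrite add1n factS lognM ?fact_gt0 //; lia.
Qed.

(** Since [a j] divides [a s], each floor splits exactly into a multiple of [n] and a floor of
    [r]. *)
Lemma logn_orial_digits (n r : nat) : (r < a s)%N ->
  logn p `|orial C (a s * n + r)| =
    (n * (\sum_(1 <= j < s.+1) a s %/ a j) +
     \sum_(1 <= j < s.+1) r %/ a j + logn p n`!)%N.
Proof.
move=> hr; have as0 : (0 < a s)%N by apply: leq_ltn_trans hr.
rewrite logn_orial; congr (_ + logn p _`!)%N; last first.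
  by rewrite mulnC divnMDl // divn_small // addn0.
rewrite big_distrr -big_split /=; apply: eq_big_nat => j jP.
have dv : (a j %| a s)%N by apply: acc_alpha_dvd; rewrite -ltnS.
have aj0 : (0 < a j)%N by apply: acc_alpha_gt0; case/andP: jP.
by rewrite -{1}(divnK dv) mulnAC [(_ %/ _ * n)%N]mulnC divnMDl.
Qed.

End Apparition.

(** * Splitting a sum over tuples by Euclidean division *)

(* [l] is the carry into the lowest digit and [lam] the carry out of it. *)
Lemma sum_digits (V : nmodType) (k A n r l : nat)
    (F : {ffun 'I_k -> 'I_(A * n + r).+1} -> V)
    (G : {ffun 'I_k -> 'I_A} -> {ffun 'I_k -> 'I_n.+1} -> V) :
  (r < A)%N -> (l < k)%N ->
  (forall (m : {ffun 'I_k -> 'I_(A * n + r).+1}) (rr : {ffun 'I_k -> 'I_A})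
      (q : {ffun 'I_k -> 'I_n.+1}),
     (forall i, m i = A * q i + rr i :> nat)%N -> F m = G rr q) ->
  \sum_(m : {ffun 'I_k -> 'I_(A * n + r).+1} |
      (\sum_(i < k) m i + l == A * n + r)%N) F m =
  \sum_(lam < k)
    \sum_(rr : {ffun 'I_k -> 'I_A} |
        (\sum_(i < k) rr i + l == r + lam * A)%N)
      \sum_(q : {ffun 'I_k -> 'I_n.+1} | (\sum_(i < k) q i + lam == n)%N)
        G rr q.
Proof.
move NE: (A * n + r)%N F => N F rA lk FG.
have A0 : (0 < A)%N by apply: leq_ltn_trans rA.
pose carry (m : {ffun 'I_k -> 'I_N.+1}) :=
  ((\sum_(i < k) m i %% A + l) %/ A)%N.
have carry_lt m : (carry m < k)%N.
  rewrite /carry ltn_divLR //.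
  (* The remainders add up to at most [k * A.-1], and [l < k], so the total stays below [k * A]. *)
  have : (\sum_(i < k) m i %% A <= \sum_(i < k) A.-1)%N.
    by apply: leq_sum => i _; rewrite -ltnS prednK // ltn_mod.
  rewrite sum_nat_const card_ord => H.
  by apply: (@leq_ltn_trans (k * A.-1 + l)%N); nia.
rewrite (partition_big (fun m => Ordinal (carry_lt m)) xpredT) //=.
apply: eq_bigr => lam _.
rewrite pair_big /=.
(* [h] recombines quotients and remainders. Its [inord] is faithful under the constraint on the
   total, which bounds every entry by [N]. *)
pose h (x : {ffun 'I_k -> 'I_A} * {ffun 'I_k -> 'I_n.+1}) :
  {ffun 'I_k -> 'I_N.+1} := [ffun i => inord (A * x.2 i + x.1 i)].
pose h' (m : {ffun 'I_k -> 'I_N.+1}) :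
    {ffun 'I_k -> 'I_A} * {ffun 'I_k -> 'I_n.+1} :=
  ([ffun i => Ordinal (ltn_pmod (m i) A0)], [ffun i => inord (m i %/ A)]).
have div_lt (m : {ffun 'I_k -> 'I_N.+1}) i : (m i %/ A < n.+1)%N.
  rewrite ltn_divLR //; have := ltn_ord (m i).
  by move: (nat_of_ord (m i)) => c; nia.
have hE m x : h' m = x -> forall i, m i = (A * x.2 i + x.1 i)%N :> nat.
  by move=> <- i; rewrite !ffunE /= inordK ?div_lt // mulnC -divn_eq.
rewrite (reindex_onto h h'); last first.
  move=> m _; apply/ffunP => i; apply/val_inj; rewrite !ffunE /=.
  by rewrite (inordK (div_lt m i)) mulnC -divn_eq inordK.
have sumE (m : {ffun 'I_k -> 'I_N.+1})
    (x : {ffun 'I_k -> 'I_A} * {ffun 'I_k -> 'I_n.+1}) :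
    (forall i, m i = A * x.2 i + x.1 i :> nat)%N ->
    (\sum_(i < k) m i = A * \sum_(i < k) x.2 i + \sum_(i < k) x.1 i)%N /\
    (\sum_(i < k) m i %% A = \sum_(i < k) x.1 i)%N.
  move=> mE; split.
    by rewrite big_distrr -big_split; apply: eq_bigr => i _; exact: mE.
  by apply: eq_bigr => i _; rewrite mE mulnC modnMDl modn_small.
apply: eq_big => [x|x /andP [_ /eqP /hE xE]]; last by exact: FG.
apply/idP/idP.
  case/andP => /andP [/eqP sN /eqP/(congr1 val)/= cE] /eqP /hE mE.
  have [E1 E2] := sumE _ _ mE.
  move: sN cE; rewrite /carry E1 E2 => {E1 E2} sN cE.
  move: (\sum_(i < k) x.1 i)%N (\sum_(i < k) x.2 i)%N sN cE => a b sN cE.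
  (* Reading the total modulo [A] identifies the remainder of [a + l]; its quotient is the carry
     [lam]. *)
  have : ((a + l) %% A = r)%N.
    by rewrite -(modn_small rA) -(modnMDl n r A) [(n * A)%N]mulnC NE -sN
      -addnA mulnC modnMDl.
  move=> mE'; have := divn_eq (a + l) A; rewrite mE' cE => E.
  apply/andP; split; apply/eqP; first by rewrite E addnC.
  have : (A * (b + lam) = A * n)%N by nia.
  by move/eqP; rewrite eqn_pmul2l // => /eqP.
case/andP => /eqP c1 /eqP c2.
have tot : (\sum_(i < k) (A * x.2 i + x.1 i) + l = N)%N.
  rewrite big_split -big_distrr /= -addnA c1 -NE.
  by move: (\sum_(i < k) x.2 i)%N c2 => b c2; nia.
have mE i : h x i = (A * x.2 i + x.1 i)%N :> nat.
  rewrite ffunE inordK // ltnS -tot (bigD1 i) //=; lia.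
have [E1 E2] := sumE _ _ mE.
apply/andP; split; first (apply/andP; split).
- by rewrite E1 -tot big_split -big_distrr.
- apply/eqP/val_inj; rewrite /= /carry E2 c1 addnC divnMDl //.
  by rewrite divn_small // addn0.
apply/eqP; case: x {tot c1 c2 sumE E1 E2} mE => rr q /= mE.
congr pair; apply/ffunP => i; apply/val_inj; rewrite [LHS]/= ffunE /= mE mulnC.
  by rewrite modnMDl modn_small.
by rewrite divnMDl // divn_small // addn0 inordK.
Qed.

(** * Sums over ordinary factorials and the digit matrices *)

Lemma xvar_neq0 : xvar != 0.
Proof. by rewrite /xvar tofrac_eq0 polyX_eq0. Qed.

Lemma xvarD (e f : int) : xvar ^ (e + f) = xvar ^ e * xvar ^ f.
Proof. by rewrite expfzDr // xvar_neq0. Qed.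

(** The tuples have total [n - lam] although the numerator is [n!]. The additive constraint makes
    the sum empty when [n < lam]. *)
Definition fact_sum (p k n lam : nat) : ratfun :=
  \sum_(q : {ffun 'I_k -> 'I_n.+1} | (\sum_(i < k) q i + lam == n)%N)
    xvar ^ ((logn p n`!)%:Z - (\sum_(i < k) logn p (q i)`!)%N%:Z).

(** The weight [xvar ^+ lam] records the deficit of the total of [q] from [n], which appears in the
    exponent after one division by [p]. *)
Definition fact_col (p k n : nat) : 'cV[ratfun]_k :=
  \col_(lam < k) (xvar ^+ lam * fact_sum p k n lam).

Lemma fact_col0 (p k : nat) : fact_col p k 0 = (erow k)^T.
Proof.
apply/colP => lam; rewrite !mxE /fact_sum.
have sum0 (q : {ffun 'I_k -> 'I_1}) : (\sum_(i < k) q i = 0)%N.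
  by apply: big1 => i _; rewrite (ord1 (q i)).
case: (eqVneq (lam : nat) 0%N) => [E|lam0]; last first.
  by rewrite big1 ?mulr0 // => q; rewrite sum0 add0n (negbTE lam0).
rewrite E expr0 mul1r (big_pred1 [ffun=> ord0]) ?big1 ?logn1 //.
  by move=> i _; rewrite ffunE logn1.
move=> q; rewrite sum0 /=; apply/esym/eqP/ffunP => i.
by rewrite [LHS]ord1 [RHS]ord1.
Qed.

(** Row [mu] is [sum_digits] with base [p] and incoming carry [mu]. The summand ignores the
    remainders, so summing over them only counts them, which gives [Ntuples]. *)
Lemma fact_col_digit (p k n d : nat) : prime p -> (d < p)%N ->
  fact_col p k (p * n + d) = Mmat p k d *m fact_col p k n.
Proof.
move=> pr_p dp; have p0 := prime_gt0 pr_p.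
have step q t : (t < p)%N ->
    logn p (p * q + t)`! = (q + logn p q`!)%N.
  move=> tp; rewrite logn_fact_div //.
  by rewrite mulnC divnMDl // divn_small // addn0.
apply/colP => mu; rewrite !mxE.
pose G (q : {ffun 'I_k -> 'I_n.+1}) : ratfun :=
  xvar ^ ((n + logn p n`!)%:Z
          - (\sum_(i < k) (q i + logn p (q i)`!))%N%:Z).
rewrite /fact_sum (sum_digits (G := fun _ q => G q)) //; last first.
  move=> m rr q mE; rewrite /G step //; congr (_ ^ (_ - _%:Z)).
  by apply: eq_bigr => i _; rewrite mE step.
rewrite big_distrr; apply: eq_bigr => lam _ /=.
rewrite !mxE -mulrA; congr (_ * _).
rewrite sumr_const mulr_natl.
rewrite /Ntuples cardsE.
have -> : #|[pred d0 : {ffun 'I_k -> 'I_p} |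
     (\sum_(i < k) d0 i)%N%:Z == d%:Z - mu%:Z + lam%:Z * p%:Z]| =
   #|[pred rr : {ffun 'I_k -> 'I_p} |
     (\sum_(i < k) rr i + mu == d + lam * p)%N]|.
  apply: eq_card => rr; rewrite !inE; lia.
congr (_ *+ _).
rewrite /fact_sum big_distrr; apply: eq_bigr => q /eqP qE /=.
rewrite /G exprnP -xvarD big_split /=; congr (_ ^ _).
(* The difference [n - \sum q i] equals [lam] and supplies the power [xvar ^+ lam]. *)
by move: (\sum_(i < k) q i)%N qE => b qE; lia.
Qed.

Lemma fact_col_digits (p k : nat) (ds : seq nat) : prime p ->
  all (fun d => (d < p)%N) ds ->
  fact_col p k (\sum_(i < size ds) nth 0 ds i * p ^ i)%N =
    (\prod_(d <- ds) Mmat p k d) *m (erow k)^T.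
Proof.
move=> pr_p; elim: ds => [|d ds IH] /=.
  by rewrite big_ord0 big_nil mul1mx fact_col0.
case/andP => dp /IH {}IH.
rewrite big_cons -mulmxA -IH -fact_col_digit // big_ord_recl /= muln1 addnC.
congr (fact_col _ _ (_ + _)); rewrite big_distrr.
by apply: eq_bigr => i _ /=; rewrite /bump /= add1n expnS mulnCA.
Qed.

(** * Comparing exponents and assembling the formula *)

(** Gathers the positive and negative contributions into two casts of naturals, the shape produced
    by [logn_orial_digits]. *)
Lemma fexpE (p k : nat) (C : nat -> int) (s lam r : nat) (rr : 'I_k -> nat) :
  fexp p C s lam r rr =
    (lam * (\sum_(1 <= j < s.+1) alpha C (p ^ s) %/ alpha C (p ^ j)) +
     \sum_(1 <= j < s.+1) r %/ alpha C (p ^ j))%N%:Z -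
    (\sum_(i < k) \sum_(1 <= j < s.+1) rr i %/ alpha C (p ^ j))%N%:Z.
Proof.
have posz_sum := big_morph Posz PoszD (erefl 0%:Z).
rewrite /fexp sumrB addrA PoszD PoszM !posz_sum exchange_big /=.
by congr (_ - _); apply: eq_bigr => i _; rewrite posz_sum.
Qed.

Lemma padic_val_cmultinomial (C : nat -> int) (p k n : nat) (m : 'I_k -> nat) :
  strong_divisibility C ->
  padic_val p (cmultinomial C n m) =
    (logn p `|orial C n|)%:Z - (\sum_(i < k) logn p `|orial C (m i)|)%N%:Z.
Proof.
move=> hC; rewrite /cmultinomial -rmorph_prod /= padic_val_div.
- by rewrite logn_prod // => i; exact: orial_neq0.
- exact: orial_neq0.
- by apply/prodf_neq0 => i _; exact: orial_neq0.
Qed.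

Theorem theorem1p4 (C : nat -> int) (hC : strong_divisibility C)
    (p s : nat) (hp : acceptable C p s)
    (k : nat) (hk : (2 <= k)%N)
    (n : nat) (ds : seq nat) (hds : base_repr p n ds)
    (r : nat) (hr : (r < alpha C (p ^ s))%N) :
  Tsum p k C (alpha C (p ^ s) * n + r) =
  (urow p k C s r *m (\prod_(d <- ds) Mmat p k d) *m (erow k)^T) 0 0.
Proof.
have [pr_p _ _ _ _] := hp; have [_ ds_p _ nE] := hds.
rewrite -mulmxA -fact_col_digits // -nE {hds nE}.
rewrite mxE /Tsum.
set A := alpha C (p ^ s) in hr *.
(* The added 0 is the incoming carry at the lowest position. *)
under eq_bigl => m do rewrite -[X in X == _]addn0.
pose G (rr : {ffun 'I_k -> 'I_A}) (q : {ffun 'I_k -> 'I_n.+1}) : ratfun :=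
  xvar ^ ((n * (\sum_(1 <= j < s.+1) A %/ alpha C (p ^ j)) +
       \sum_(1 <= j < s.+1) r %/ alpha C (p ^ j) + logn p n`!)%N%:Z -
     (\sum_(i < k) (q i * (\sum_(1 <= j < s.+1) A %/ alpha C (p ^ j)) +
       \sum_(1 <= j < s.+1) rr i %/ alpha C (p ^ j) + logn p (q i)`!))%N%:Z).
rewrite (sum_digits (G := G)) //; last 2 first.
- exact: ltnW.
- move=> m rr q mE; rewrite padic_val_cmultinomial // logn_orial_digits //.
  congr (_ ^ (_ - _%:Z)); apply: eq_bigr => i _.
  by rewrite mE logn_orial_digits.
apply: eq_bigr => lam _; rewrite !mxE /u_coef /fact_sum big_distrl /=.
apply: eq_big => [rr|rr _]; first by rewrite addn0.
(* The [- lam] in the exponent of [u_coef] cancels the weight of [fact_col]. *)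
rewrite mulrA exprnP -xvarD subrK big_distrr /=.
apply: eq_bigr => q /eqP qE; rewrite -xvarD /G; congr (_ ^ _).
rewrite fexpE -/A !big_split -big_distrl /=.
set S := (\sum_(1 <= j < s.+1) _)%N.
(* Multiplying [\sum q i + lam = n] by [S] turns the difference of the [S] terms into [lam * S], the
   first term of [fexp]. *)
by have := congr1 (muln^~ S) qE; rewrite /= mulnDl; lia.
Qed.
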